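(* For all real $\varepsilon > 0$ there exists an integer $N(\varepsilon)$ such that, for all integers $m > n > N(\varepsilon)$, we have \[ \left|\frac{1}{p_n} - \frac{1}{p_m}\right| \geq \frac{1}{6} \cdot \left|\frac{1}{n} - \frac{1}{m}\right|^{1+\varepsilon}. \]
   Context: $p_n$ denotes the $n$th prime number, indexed by positive integers $n \geq 1$ in increasing order ($p_1 = 2$, $p_2 = 3$, ...). The indices $m,n$ are positive integers. *)

(* Defs.v *)
From mathcomp Require Import all_boot.

Set Implicit Arguments.
Unset Strict Implicit.
Unset Printing Implicit Defensive.

Lemma ex_prime_above (m : nat) : exists p : nat, (m < p) && prime p.
Proof. by have [p lt_mp pr_p] := prime_above m; exists p; rewrite lt_mp. Qed.

Definition next_prime (m : nat) : nat := ex_minn (ex_prime_above m).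

(* The primes are indexed from 1: nth_prime 1 = 2, nth_prime 2 = 3.
   The value nth_prime 0 = 0 is junk. *)
Definition nth_prime (n : nat) : nat := iter n next_prime 0.

Lemma nth_prime1 : nth_prime 1 = 2.
Proof.
rewrite /nth_prime /= /next_prime; case: ex_minnP => p /andP[_ pr_p] p_min.
by apply/eqP; rewrite eqn_leq prime_gt1 // p_min.
Qed.

Lemma nth_prime_prime (n : nat) : 0 < n -> prime (nth_prime n).
Proof.
case: n => // n _; rewrite /nth_prime iterS /next_prime.
by case: ex_minnP => p /andP[].
Qed.

Lemma nth_prime_ltS (n : nat) : nth_prime n < nth_prime n.+1.
Proof.
by rewrite /nth_prime iterS {2}/next_prime; case: ex_minnP => p /andP[].
Qed.

Lemma nth_prime_surj (q : nat) :
  prime q -> exists2 n : nat, 0 < n & nth_prime n = q.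
Proof.
move=> pr_q; have lt_n n : n <= nth_prime n.
  by elim: n => // n /leq_ltn_trans; apply; apply: nth_prime_ltS.
have ex_n : exists n, q <= nth_prime n by exists q.
case: (ex_minnP ex_n) => -[|n] le_qn n_min.
  by move: (prime_gt0 pr_q); rewrite ltnNge le_qn.
exists n.+1 => //; apply/eqP; rewrite eqn_leq le_qn andbT.
have lt_nq : nth_prime n < q.
  by rewrite ltnNge; apply/negP => /n_min; rewrite ltnn.
rewrite /nth_prime iterS -/(nth_prime n) /next_prime.
by case: ex_minnP => p _; apply; rewrite lt_nq.
Qed.

(* Main.v *)
(** Chebyshev's bound gives p_n <= n^(1+d) for every d > 0 and all large n.
    If m <= n^2, then p_m - p_n >= m - n and p_n p_m <= n m n^(3d), so the
    left-hand side is at least t n^(-3d) with t = 1/n - 1/m <= 1/n, while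
    t^(1+eps) <= t n^(-eps). If m > n^2, then p_m >= m >= 2 p_n, so the
    left-hand side is at least 1/(2 p_n). *)
Require Import Defs.
From mathcomp Require Import all_boot all_order all_algebra.
From mathcomp Require Import reals exp.
From mathcomp Require Import zify ring lra.

Import Order.TTheory GRing.Theory Num.Theory.

(** * Prime factorisation of central binomial coefficients *)

Section CentralBinomial.
Local Open Scope nat_scope.

(** Legendre's formula for the three factorials; padding each sum with zero terms up to [n] lets
    them be subtracted term by term. *)
Lemma logn_bin (p n m : nat) : prime p -> m <= n ->
  logn p 'C(n, m) =
    \sum_(1 <= i < n.+1) (n %/ p ^ i - (m %/ p ^ i + (n - m) %/ p ^ i)).
Proof.
move=> pr_p le_mn.
have := congr1 (logn p) (bin_fact le_mn).
rewrite !lognM ?muln_gt0 ?fact_gt0 ?bin_gt0 //.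
have logn_fact_wide k : k <= n -> logn p k`! = \sum_(1 <= i < n.+1) k %/ p ^ i.
  move=> le_kn; rewrite logn_fact // (@big_cat_nat _ _ _ k.+1 1 n.+1) //=.
  rewrite [X in _ = _ + X]big_nat_cond [X in _ = _ + X]big1 ?addn0 //.
  move=> i /andP[/andP[lt_ki _] _]; apply: divn_small.
  exact: ltn_trans lt_ki (ltn_expl _ (prime_gt1 pr_p)).
rewrite !logn_fact_wide ?leq_subr // -big_split /= => logE.
rewrite sumnB => [|i _]; first by rewrite -logE addnK.
by rewrite -{2}(subnKC le_mn) divnD ?expn_gt0 ?prime_gt0 // leq_addr.
Qed.

(** Each term of [logn_bin] is a carry, 0 or 1, and vanishes once [p ^ i] exceeds [n], so the
    exponent is at most [trunc_log p n]. *)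
Lemma expn_logn_bin_le (p n m : nat) : prime p -> 0 < n ->
  p ^ logn p 'C(n, m) <= n.
Proof.
move=> pr_p n_gt0; have p_gt1 := prime_gt1 pr_p.
have [lt_nm | le_mn] := ltnP n m; first by rewrite bin_small // logn0.
apply: leq_trans (trunc_logP p_gt1 n_gt0).
rewrite leq_exp2l // logn_bin //; set t := trunc_log p n.
have le_tn : t <= n.
  by apply: leq_trans (trunc_logP p_gt1 n_gt0); apply/ltnW/ltn_expl.
rewrite (@big_cat_nat _ _ _ t.+1) //= [X in _ + X]big_nat_cond.
rewrite [X in _ + X]big1 ?addn0 => [|i /andP[/andP[lt_ti _] _]].
  apply: (@leq_trans (\sum_(1 <= i < t.+1) 1)).
    apply: leq_sum => i _.
    rewrite leq_subLR -{1}(subnKC le_mn) divnD ?expn_gt0 ?prime_gt0 //.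
    by rewrite leq_add2l leq_b1.
  by rewrite sum_nat_const_nat subn1 muln1.
rewrite divn_small ?sub0n //; apply: leq_trans (trunc_log_ltn n p_gt1) _.
by rewrite leq_exp2l.
Qed.

(** Pascal's rule splits the next central coefficient into two terms, each at least the current
    one. *)
Lemma expn2_le_central_bin (k : nat) : 2 ^ k <= 'C(k.*2, k).
Proof.
elim: k => // k IHk; rewrite doubleS expnS mul2n -addnn binS.
have le_bin : 'C(k.*2, k) <= 'C(k.*2.+1, k) by apply: leq_bin2l.
apply: leq_add; last exact: leq_trans le_bin.
by rewrite binS (leq_trans IHk) // leq_addl.
Qed.

Lemma leq_nth_prime : {homo nth_prime : m n / m <= n}.
Proof.
by apply: homo_leq leqnn leq_trans _ => n; apply/ltnW/nth_prime_ltS.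
Qed.

Lemma nth_prime_sub (m n : nat) : n <= m -> m - n <= nth_prime m - nth_prime n.
Proof.
move/subnK=> <-; rewrite addnK; elim: (m - n) => // k IHk.
rewrite addSn; apply: leq_ltn_trans IHk _; apply: ltn_sub2r.
  exact: leq_ltn_trans (leq_nth_prime _ _ (leq_addl k n)) (nth_prime_ltS _).
exact: nth_prime_ltS.
Qed.

Lemma nth_prime_ge (n : nat) : n <= nth_prime n.
Proof. by have := nth_prime_sub _ _ (leq0n n); rewrite !subn0. Qed.

(* Each prime power dividing 'C(2k, k) is at most 2k, and only the first n
   primes can occur, so 2^k <= 'C(2k, k) <= (2k)^n. *)
Lemma expn2_le_nth_prime_exp (n : nat) : 0 < n ->
  2 ^ (nth_prime n).-1./2 <= nth_prime n ^ n.
Proof.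
move=> n_gt0; have p_gt0 := prime_gt0 (nth_prime_prime n_gt0).
(* This [k] is the largest with 2k < P, which keeps all prime factors of 'C(2k, k) below the [n]th
   prime. *)
set P := nth_prime n in p_gt0 *; set k := P.-1./2.
have [-> | k_gt0] := posnP k; first by rewrite expn_gt0 p_gt0.
have lt_kP : k.*2 < P.
  by rewrite -(prednK p_gt0) ltnS -[leqRHS]odd_double_half leq_addl.
apply: leq_trans (expn2_le_central_bin k) _.
have C_gt0 : 0 < 'C(k.*2, k) by rewrite bin_gt0 -addnn leq_addr.
rewrite [leqLHS]prod_prime_decomp // prime_decompE big_map /=.
apply: (@leq_trans (\prod_(q <- primes 'C(k.*2, k)) P)).
  rewrite big_seq [leqRHS]big_seq; apply: leq_prod => q.
  rewrite mem_primes => /and3P[pr_q _ _].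
  by apply/(leq_trans _ (ltnW lt_kP))/expn_logn_bin_le; rewrite ?double_gt0.
rewrite big_const_seq count_predT -Monoid.iteropE -/(expn _ _).
rewrite leq_exp2l ?prime_gt1 ?nth_prime_prime //.
rewrite -[leqRHS](size_iota 1) -(size_map nth_prime (iota 1 n)).
apply: uniq_leq_size (primes_uniq _) _ => q.
rewrite mem_primes => /and3P[pr_q _ q_dvd].
have [i i_gt0 def_q] := nth_prime_surj pr_q.
apply/mapP; exists i => //; rewrite mem_iota i_gt0 add1n ltnS.
rewrite leqNgt; apply/negP => lt_ni.
have lt_Pq : P < q.
  by rewrite -def_q (leq_trans (nth_prime_ltS n)) ?leq_nth_prime.
(* [q] occurs with exponent at least 1, so it is bounded by its full power in the binomial. *)
have : q <= k.*2.
  apply: leq_trans (expn_logn_bin_le q _ k pr_q _); last by rewrite double_gt0.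
  rewrite -[leqLHS]expn1 leq_exp2l ?prime_gt1 // logn_gt0 mem_primes pr_q.
  by rewrite C_gt0.
by rewrite leqNgt (ltn_trans lt_kP).
Qed.
End CentralBinomial.

(** * From Chebyshev's bound to a power bound on the primes *)

Section RealBound.
Local Open Scope ring_scope.
Variable R : realType.
Implicit Types x y : R.

(** This is ln y < y at y = x^a. *)
Lemma ln_le_powR x (a : R) : 0 < a -> 0 < x -> ln x <= x `^ a / a.
Proof.
move=> a_gt0 x_gt0; rewrite ler_pdivlMr // mulrC -ln_powR.
by apply/ltW/ln_sublinear/powR_gt0.
Qed.

Lemma ln2_ge_half : 2^-1 <= ln 2 :> R.
Proof.
have : ln (1 + - 2^-1) <= - 2^-1 :> R by apply: le_ln1Dx; lra.
rewrite (_ : 1 + - 2^-1 = 2^-1 :> R); last by lra.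
by rewrite lnV ?posrE // lerN2.
Qed.

(** Logarithms of 2^k <= P^n give k ln 2 <= n ln P. The 8 comes from P <= 4k, valid as P >= 4, and
    ln 2 >= 1/2. *)
Lemma nth_prime_le_ln (n : nat) : (3 < n)%N ->
  (nth_prime n)%:R <= 8 * n%:R * ln (nth_prime n)%:R :> R.
Proof.
move=> n_gt3; have P_ge4 := leq_trans n_gt3 (nth_prime_ge n).
have := expn2_le_nth_prime_exp n (ltn_trans (isT : 0 < 3)%N n_gt3).
move: P_ge4; set P := nth_prime n => P_ge4; set k := P.-1./2 => le_exp.
have P_gt0 : 0 < P%:R :> R by rewrite ltr0n (leq_trans _ P_ge4).
have : k%:R * ln 2 <= n%:R * ln P%:R :> R.
  rewrite [leLHS]mulr_natl [leRHS]mulr_natl -!lnXn // ler_ln ?posrE ?exprn_gt0 //.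
  by rewrite -!natrX ler_nat.
have : P%:R <= 4 * k%:R :> R.
  rewrite -natrM ler_nat /k.
  have := odd_double_half P.-1; move: (odd _) => [] /=; lia.
have := ln2_ge_half; have : 0 <= k%:R :> R by [].
nra.
Qed.

Lemma nth_prime_le_powR (d : R) : 0 < d ->
  exists N : nat, forall n : nat, (N < n)%N ->
    (nth_prime n)%:R <= n%:R `^ (1 + d).
Proof.
(* Chosen so that (1 + d)(1 - a) = 1 + a: if P > n^(1+d), then P^(1-a) > n n^a, whereas ln P <= P^a
   / a forces P^(1-a) <= 8n/a. These clash once n^a > 8/a, which fixes the threshold. *)
move=> d_gt0; pose a := d / (2 + d).
have a_gt0 : 0 < a by rewrite divr_gt0 //; lra.
have a_lt1 : a < 1 by rewrite ltr_pdivrMr; lra.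
have expE : (1 + d) * (1 - a) = 1 + a by rewrite /a; field; lra.
exists (maxn 3 (Num.bound ((8 / a) `^ a^-1))) => n.
rewrite gtn_max => /andP[n_gt3 lt_n].
have n_gt0 : 0 < n%:R :> R by rewrite ltr0n (leq_trans _ n_gt3).
have na_gt : 8 / a < n%:R `^ a.
  have c_ge0 : 0 <= 8 / a by rewrite divr_ge0 // ltW.
  have -> : 8 / a = ((8 / a) `^ a^-1) `^ a.
    by rewrite -powRrM mulVf ?lt0r_neq0 // powRr1.
  apply: gt0_ltr_powR; rewrite ?nnegrE ?powR_ge0 ?ltW //.
  apply: lt_trans (archi_boundP (powR_ge0 _ _)) _.
  by rewrite ltr_nat.
have := nth_prime_le_ln n n_gt3; set P := (nth_prime n)%:R => le_P.
have P_gt0 : 0 < P.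
  by rewrite ltr0n (leq_trans _ (nth_prime_ge n)) // (leq_trans _ n_gt3).
rewrite leNgt; apply/negP => lt_P.
have := ln_le_powR P a a_gt0 P_gt0 => le_ln.
have lt1 : n%:R * n%:R `^ a < P `^ (1 - a).
  rewrite -{1}(powRr1 (ltW n_gt0)) -powRD ?lt0r_neq0 ?implybT // -expE powRrM.
  by apply: gt0_ltr_powR; rewrite ?nnegrE ?powR_ge0 ?subr_gt0 // ltW.
have PE : P = P `^ (1 - a) * P `^ a.
  by rewrite -powRD ?subrK ?powRr1 ?lt0r_neq0 ?implybT // ltW.
have : P `^ (1 - a) * P `^ a <= n%:R * (8 / a) * P `^ a.
  rewrite -PE; apply: le_trans le_P _.
  rewrite (_ : n%:R * (8 / a) * P `^ a = 8 * n%:R * (P `^ a / a)); last by ring.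
  by rewrite ler_wpM2l // mulr_ge0 // ltW.
rewrite ler_pM2r ?powR_gt0 // leNgt => /negP; apply.
by apply: lt_trans lt1; rewrite ltr_pM2l.
Qed.

End RealBound.

Local Open Scope ring_scope.

Theorem theorem1p1 (R : realType) (eps : R) :
  0 < eps ->
  exists N : nat, forall m n : nat, (N < n)%N -> (n < m)%N ->
    `| ((nth_prime n)%:R)^-1 - ((nth_prime m)%:R)^-1 | >=
      6^-1 * (`| n%:R^-1 - m%:R^-1 | `^ (1 + eps)) :> R.
Proof.
(* The bound eps/3 serves the case m <= n^2, where n^(3d) appears; the bound 1/2 serves m > n^2,
   where p_n <= n^(3/2) is wanted. *)
move=> eps_gt0; pose d : R := Num.min (eps / 3) 2^-1.
have d_gt0 : 0 < d by rewrite lt_min; apply/andP; split; lra.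
have d_le_eps : d <= eps / 3 by rewrite ge_min lexx.
have d_le_half : d <= 2^-1 by rewrite ge_min lexx orbT.
clearbody d.
have [N le_prime] := nth_prime_le_powR R d d_gt0.
exists (maxn 3 N) => m n; rewrite gtn_max => /andP[n_gt3 lt_Nn] lt_nm.
have leX := le_prime n lt_Nn; have leY := le_prime m (ltn_trans lt_Nn lt_nm).
have leD : m%:R - n%:R <= (nth_prime m)%:R - (nth_prime n)%:R :> R.
  rewrite -!natrB ?leq_nth_prime ?(ltnW lt_nm) // ler_nat.
  exact/nth_prime_sub/ltnW.
have le_mY : m%:R <= (nth_prime m)%:R :> R by rewrite ler_nat nth_prime_ge.
have le_nX : n%:R <= (nth_prime n)%:R :> R by rewrite ler_nat nth_prime_ge.
have u_ge4 : 4 <= n%:R :> R by rewrite ler_nat.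
have lt_uv : n%:R < m%:R :> R by rewrite ltr_nat.
(* The rest is real analysis: [u], [v], [X], [Y] stand for n, m, p_n, p_m. *)
move: n%:R m%:R (nth_prime n)%:R (nth_prime m)%:R {le_prime}
  leX leY leD le_mY le_nX u_ge4 lt_uv => u v X Y.
move=> leX leY leD le_vY le_uX u_ge4 lt_uv.
have u_gt0 : 0 < u by lra.
have v_gt0 : 0 < v by lra.
have X_gt0 : 0 < X by lra.
have Y_gt0 : 0 < Y by lra.
have [u_ge0 v_ge0 X_ge0] := And3 (ltW u_gt0) (ltW v_gt0) (ltW X_gt0).
set t := `|u^-1 - v^-1|; set w := u `^ eps.
have w_gt0 : 0 < w by apply: powR_gt0.
have tE : t = (v - u) / (u * v).
  rewrite /t ger0_norm; first by field; rewrite !lt0r_neq0.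
  by rewrite subr_ge0 lef_pV2 ?posrE // ltW.
have t_gt0 : 0 < t by rewrite tE divr_gt0 ?mulr_gt0 ?subr_gt0.
have t_ge0 := ltW t_gt0.
have t_le : t <= u^-1.
  rewrite /t ger0_norm; first by rewrite gerBl invr_ge0.
  by rewrite subr_ge0 lef_pV2 ?posrE // ltW.
have t_powR : t `^ (1 + eps) <= t / w.
  rewrite powRD ?lt0r_neq0 ?implybT // powRr1 // ler_pM2l //.
  rewrite /w -powRN -mulN1r powRrM powR_inv1 //.
  by apply: ge0_ler_powR; rewrite ?nnegrE ?invr_ge0 // ltW.
have leXw : X <= u * u `^ d.
  by rewrite -{1}(powRr1 (ltW u_gt0)) -powRD // lt0r_neq0 ?implybT.
have le_dw : u `^ d <= w by apply: ler_powR; lra.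
have [le_vu2 | lt_u2v] := leP v (u ^+ 2).
(* Here v^d <= (u^2)^d. *)
- have leYw : Y <= v * u `^ (2 * d).
    apply: le_trans leY _; rewrite powRD ?lt0r_neq0 ?implybT // powRr1 //.
    rewrite ler_pM2l // powRrM powR_mulrn //.
    by apply: ge0_ler_powR; rewrite ?nnegrE ?sqr_ge0 // ltW.
  have leXYw : X * Y <= u * v * w.
    apply: (@le_trans _ _ ((u * u `^ d) * (v * u `^ (2 * d)))).
      by apply: ler_pM; rewrite // ltW.
    rewrite mulrACA ler_pM2l ?mulr_gt0 // -powRD ?lt0r_neq0 ?implybT //.
    by apply: ler_powR; lra.
  have le_t : t / w <= `|X^-1 - Y^-1|.
    apply: le_trans (ler_norm _).
    rewrite (_ : X^-1 - Y^-1 = (Y - X) / (X * Y)); last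
       by field; rewrite !lt0r_neq0.
    rewrite tE -mulrA -invfM; apply: ler_pM => //.
    + by rewrite subr_ge0 ltW.
    + by rewrite invr_ge0 ltW ?mulr_gt0.
    + by rewrite lef_pV2 ?posrE ?mulr_gt0.
  have : 0 <= t / w by rewrite divr_ge0 ?ltW.
  lra.
(* With u >= 4, 2X <= 2u u^(1/2) <= u^2 < v <= Y. *)
- have sqrt_ge2 : 2 <= u `^ 2^-1.
    rewrite powR12_sqrt // (_ : 2 = Num.sqrt (2 ^+ 2)).
      by rewrite ler_sqrt // -natrX.
    by rewrite sqrtr_sqr ger0_norm.
  have sqrtE : u `^ 2^-1 * u `^ 2^-1 = u.
    by rewrite powR12_sqrt // -expr2 sqr_sqrtr.
  have le_d_half : u `^ d <= u `^ 2^-1 by apply: ler_powR; lra.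
  have le_u_half : u * u `^ d <= u * u `^ 2^-1 by rewrite ler_pM2l.
  have : u * (2 * u `^ 2^-1) <= u * u.
    by rewrite ler_pM2l // -[leRHS]sqrtE ler_pM2r ?powR_gt0.
  rewrite expr2 in lt_u2v => le_2us; have le_2XY : 2 * X <= Y by lra.
  have leX_uw : X <= u * w by apply: le_trans leXw _; rewrite ler_pM2l.
  have le_tw : t / w <= X^-1.
    apply: (@le_trans _ _ (u * w)^-1); last by rewrite lef_pV2 ?posrE ?mulr_gt0.
    by rewrite invfM ler_pM2r ?invr_gt0.
  (* Hence 1/X - 1/Y >= 1/(2X) >= t/(2w), and 1/2 exceeds the required 1/6. *)
  have leYV : Y^-1 <= X^-1 / 2.
    by rewrite -invfM lef_pV2 ?posrE ?mulr_gt0 // mulrC.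
  have := ler_norm (X^-1 - Y^-1).
  have : 0 < X^-1 by rewrite invr_gt0.
  lra.
Qed.
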